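(* Let $S,T$ be inverse semigroups and $\theta\colon S\to T$ a semigroup homomorphism. The pair $(\theta,\widehat\theta)$ is a proper action morphism from the spectral action $(S,\widehat{E(S)},\beta^S)$ to the spectral action $(T,\widehat{E(T)},\beta^T)$.
   Context: Partial maps: a partial map $f\colon X\supset D_f\to Y$ is a continuous map from an open subspace $D_f\subset X$ to $Y$. For $V\subset Y$, $f^{-1}(V):=\{x\in D_f: f(x)\in V\}$. $f$ is proper if $f^{-1}(C)$ is compact for every compact $C\subset Y$. Composition: $f_2\circ f_1$ has domain $f_1^{-1}(D_{f_2})$. An inverse semigroup is a semigroup $S$ in which every $s$ has a unique $s^*$ with $ss^*s=s$, $s^*ss^*=s^*$; $E(S)=\{e\in S:e^2=e\}$ is a commutative subsemigroup. $I(X)$ is the inverse semigroup of all homeomorphisms between open subspaces of $X$ under composition of partial maps. An inverse semigroup action $(S,X,\alpha)$ is an inverse semigroup $S$, a topological space $X$ and a semigroup homomorphism $\alpha\colon S\to I(X)$ with $\bigcup_{s}D^\alpha_s=X$, where $D^\alpha_s$ is the domain of $\alpha_s$. An action morphism $(\theta,\xi)\colon(S,X,\alpha)\to(T,Y,\beta)$ consists of a semigroup homomorphism $\theta\colon S\to T$ and a partial map $\xi\colon Y\supset D_\xi\to X$ such that (i) $\xi^{-1}(D^\alpha_s)=D^\beta_{\theta(s)}$ for every $s\in S$; (ii) $\alpha_s(\xi(y))=\xi(\beta_{\theta(s)}(y))$ for every $s\in S$, $y\in\xi^{-1}(D^\alpha_s)$. It is proper if $\xi$ is proper. Spectral action: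 $\widehat{E(S)}_0$ is the set of all semigroup homomorphisms $E(S)\to\{0,1\}$ (usual multiplication), a closed subspace of the product space $\{0,1\}^{E(S)}$ (with $\{0,1\}$ discrete); $\widehat{E(S)}:=\widehat{E(S)}_0\setminus\{0\}$, where $0$ is the constant zero homomorphism; this is locally compact Hausdorff. For $e\in E(S)$ put $U^S_e:=\{\zeta\in\widehat{E(S)}:\zeta(e)=1\}$, and for $s\in S$ put $U^S_s:=U^S_{s^*s}$. The spectral action $(S,\widehat{E(S)},\beta^S)$ is given by the partial homeomorphisms $\beta^S_s\colon U^S_s\to U^S_{s^*}$, $\beta^S_s(\zeta)(e)=\zeta(s^*es)$. For a semigroup homomorphism $\theta\colon S\to T$, let $\theta_*\colon\widehat{E(T)}_0\to\widehat{E(S)}_0$, $\zeta\mapsto\zeta\circ\theta|_{E(S)}$. The partial map $\widehat\theta\colon\widehat{E(T)}\supset D_{\widehat\theta}\to\widehat{E(S)}$ has domain $D_{\widehat\theta}:=\theta_*^{-1}(\widehat{E(S)})$ and is given by $\widehat\theta(\zeta)=\theta_*(\zeta)$. *)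

(* Defs.v *)
From HB Require Import structures.
From mathcomp Require Import all_boot.
From mathcomp Require Import monoid.
From mathcomp Require Import all_classical.
From mathcomp Require Import topology.

Set Implicit Arguments.
Unset Strict Implicit.
Unset Printing Implicit Defensive.

Local Open Scope group_scope.
Local Open Scope classical_set_scope.

HB.mixin Record Semigroup_isInverse S of Semigroup S := {
  star : S -> S;
  mul_starK : forall s : S, s * star s * s = s;
  star_mulK : forall s : S, star s * s * star s = star s;
  star_uniq : forall s t : S, s * t * s = s -> t * s * t = t -> t = star s
}.

#[short(type="invSemigroupType")]
HB.structure Definition InvSemigroup :=
  {S of Semigroup_isInverse S & Semigroup S}.

Notation "s ^*" := (star s) : group_scope.

Section InvSemigroupTheory.
Variable S : invSemigroupType.
Implicit Types s t e f : S.

Lemma starK s : s^*^* = s.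
Proof. by apply/esym/star_uniq; [exact: star_mulK | exact: mul_starK]. Qed.

Lemma idem_star e : e * e = e -> e^* = e.
Proof. by move=> ee; apply/esym/star_uniq; rewrite !ee. Qed.

Lemma mulVs_idem s : (s^* * s) * (s^* * s) = s^* * s.
Proof. by rewrite !mulgA star_mulK. Qed.

Lemma mulsV_idem s : (s * s^*) * (s * s^*) = s * s^*.
Proof. by rewrite !mulgA mul_starK. Qed.

Lemma idemM e f : e * e = e -> f * f = f -> (e * f) * (e * f) = e * f.
Proof.
move=> ee ff; set x := (e * f)^*.
have x1 : e * f * x * (e * f) = e * f := mul_starK _.
have x2 : x * (e * f) * x = x := star_mulK _.
have xE : f * x * e = x.
  apply: star_uniq.
    rewrite -[RHS]x1 !mulgA -(mulgA e f f) ff.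
    by rewrite -(mulgA (e * f * x) e e) ee.
  rewrite !mulgA -(mulgA (f * x) e e) ee -(mulgA (f * x * e) f f) ff.
  by congr (_ * e); rewrite -[in RHS]x2 !mulgA.
have xx : x * x = x.
  rewrite -[in LHS]xE !mulgA -[RHS]xE.
  by congr (_ * e); rewrite -[in RHS]x2 !mulgA.
have <- : x = e * f by rewrite -[RHS]starK -/x idem_star.
exact: xx.
Qed.

Lemma idemC e f : e * e = e -> f * f = f -> e * f = f * e.
Proof.
move=> ee ff; have efi := idemM ee ff; have fei := idemM ff ee.
rewrite -{1}(idem_star efi); apply/esym/star_uniq.
  by rewrite -[RHS]efi !mulgA -(mulgA e f f) ff -(mulgA (e * f) e e) ee.
by rewrite -[RHS]fei !mulgA -(mulgA f e e) ee -(mulgA (f * e) f f) ff.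
Qed.

Lemma conj_idem s e : e * e = e -> (s^* * e * s) * (s^* * e * s) = s^* * e * s.
Proof.
move=> ee.
have -> : (s^* * e * s) * (s^* * e * s) = s^* * (e * (s * s^*)) * (e * s).
  by rewrite !mulgA.
rewrite (idemC ee (mulsV_idem s)) !mulgA star_mulK.
by rewrite -(mulgA s^* e e) ee.
Qed.

Lemma starM s t : (s * t)^* = t^* * s^*.
Proof.
apply/esym/star_uniq.
  have -> : s * t * (t^* * s^*) * (s * t)
          = s * ((t * t^*) * (s^* * s)) * t by rewrite !mulgA.
  rewrite (idemC (mulsV_idem t) (mulVs_idem s)) !mulgA mul_starK.
  by rewrite -!mulgA (mulgA t) mul_starK.
have -> : t^* * s^* * (s * t) * (t^* * s^*)
        = t^* * ((s^* * s) * (t * t^*)) * s^* by rewrite !mulgA.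
rewrite (idemC (mulVs_idem s) (mulsV_idem t)) !mulgA star_mulK.
by rewrite -!mulgA (mulgA s^*) star_mulK.
Qed.

End InvSemigroupTheory.

Record idem (S : invSemigroupType) := Idem {
  idem_val : S;
  idem_valP : idem_val * idem_val == idem_val
}.

Section Idempotents.
Variable S : invSemigroupType.

HB.instance Definition _ := [isSub for @idem_val S].
HB.instance Definition _ := [Choice of idem S by <:].

Implicit Types e f : idem S.

Lemma idemE e : idem_val e * idem_val e = idem_val e.
Proof. exact/eqP/idem_valP. Qed.

Fact mul_idem_subproof e f : (idem_val e * idem_val f) * (idem_val e * idem_val f) ==
  idem_val e * idem_val f.
Proof. by apply/eqP/idemM; exact: idemE. Qed.

Definition mul_idem e f : idem S := Idem (mul_idem_subproof e f).

Fact mul_idemA : associative mul_idem.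
Proof. by move=> e f g; apply: val_inj; rewrite /= mulgA. Qed.

HB.instance Definition _ := isSemigroup.Build (idem S) mul_idemA.

Fact conjs_subproof (s : S) e :
  (s^* * idem_val e * s) * (s^* * idem_val e * s) == s^* * idem_val e * s.
Proof. by apply/eqP/conj_idem/idemE. Qed.

(* s^* e s *)
Definition conjs (s : S) e : idem S := Idem (conjs_subproof s e).

Fact src_subproof (s : S) : (s^* * s) * (s^* * s) == s^* * s.
Proof. exact/eqP/mulVs_idem. Qed.

(* s^* s *)
Definition src (s : S) : idem S := Idem (src_subproof s).

Lemma mul_idemC e f : e * f = f * e.
Proof. by apply: val_inj; apply: idemC; exact: idemE. Qed.

End Idempotents.

(* A partial map is encoded as f : X -> option Y, undefined where the value is
   None, so that Leibniz equality is equality of domains and values. *)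
Section PartialMaps.
Context {X Y Z : Type}.
Implicit Types f : X -> option Y.

Definition pdom f : set X := [set x | isSome (f x)].

Definition ppreim f (V : set Y) : set X := [set x | exists2 y, f x = Some y & V y].

Definition pcomp (g : Y -> option Z) f : X -> option Z := fun x => obind g (f x).

End PartialMaps.

Definition partial_map (X Y : topologicalType) (f : X -> option Y) : Prop :=
  open (pdom f) /\
  exists2 g : pdom f -> Y,
    continuous g & forall x : pdom f, f (set_val x) = Some (g x).

Definition proper_map (X Y : topologicalType) (f : X -> option Y) : Prop :=
  forall C : set Y, compact C -> compact (ppreim f C).

(* homeomorphisms between open subspaces of X *)
Definition partial_homeo (X : topologicalType) (f : X -> option X) : Prop :=
  partial_map f /\
  exists2 g : X -> option X,
    partial_map g & forall x y, f x = Some y <-> g y = Some x.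

Lemma partial_mapP (X Y : topologicalType) (f : X -> option Y) :
  partial_map f <->
  forall x y, f x = Some y -> forall V, nbhs y V -> nbhs x (ppreim f V).
Proof.
split=> [[oD [g cg fg]] x y fxy V yV|fV].
  have Dx : x \in pdom f by rewrite inE /pdom /= fxy.
  have gx : g (exist _ x Dx) = y.
    by have := fg (exist _ x Dx); rewrite fxy => -[].
  have nV : nbhs (exist _ x Dx : pdom f) (g @^-1` V) by apply: cg; rewrite gx.
  move: (nV); rewrite (@nbhsE (set_type (pdom f))) => -[U [[W oW WU] Ux] UV].
  have Wx : W x by move: Ux; rewrite -WU.
  have : nbhs x (W `&` pdom f).
    by apply: open_nbhs_nbhs; split; [exact: openI | split=> //; exact: set_mem].
  apply: filterS.
  move=> z [Wz Dz]; have Dz' := mem_set Dz.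
  exists (g (exist _ z Dz')); first exact: (fg (exist _ z Dz')).
  by apply: UV; rewrite -WU.
have oD : open (pdom f).
  rewrite openE /interior => x Dx.
  have [y fx] : exists y, f x = Some y.
    by move: Dx; rewrite /pdom /=; case: (f x) => // y _; exists y.
  have : nbhs x (ppreim f setT) by apply: (fV x y fx setT); exact: filterT.
  apply: filterS => z [w fz _].
  by rewrite /pdom /= fz.
split=> //.
have /choice[g gP] : forall x : pdom f, exists y, f (set_val x) = Some y.
  move=> [x Dx]; have := set_mem Dx; rewrite /pdom /=.
  by case: (f x) => [y|] // _; exists y.
exists g => // x V gxV.
have nV : nbhs x (set_val @^-1` ppreim f V).
  by apply: (@initial_continuous (pdom f) X set_val); exact: fV (gP x) _ gxV.
change (nbhs x (g @^-1` V)); apply: filterS nV.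
by move => z [y /=]; rewrite gP => -[<-].
Qed.

Lemma pcomp_partial_map (X Y Z : topologicalType) (g : Y -> option Z)
    (f : X -> option Y) :
  partial_map g -> partial_map f -> partial_map (pcomp g f).
Proof.
move=> /partial_mapP gP /partial_mapP fP; apply/partial_mapP => x z.
rewrite /pcomp; case fx: (f x) => [y|] //= gy V zV.
have := fP _ _ fx _ (gP _ _ gy _ zV); apply: filterS => x' [y' fx' [z' gy' Vz']].
by exists z' => //; rewrite fx'.
Qed.

Lemma pcomp_partial_homeo (X : topologicalType) (f g : X -> option X) :
  partial_homeo g -> partial_homeo f -> partial_homeo (pcomp g f).
Proof.
move=> [gp [g' g'p gg']] [fp [f' f'p ff']].
split; first exact: pcomp_partial_map.
exists (pcomp f' g'); first exact: pcomp_partial_map.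
move=> x z; rewrite /pcomp; split.
  by case fx: (f x) => [y|] //= /gg' -> /=; apply/ff'.
by case gz: (g' z) => [y|] //= /ff' -> /=; apply/gg'.
Qed.

(* I(X) *)
Record phomeo (X : topologicalType) := Phomeo {
  phomeo_fun :> X -> option X;
  phomeoP : `[< partial_homeo phomeo_fun >]
}.

Section PhomeoSemigroup.
Variable X : topologicalType.

HB.instance Definition _ := [isSub for @phomeo_fun X].
HB.instance Definition _ := [Choice of phomeo X by <:].

Fact mul_phomeo_subproof (f g : phomeo X) : `[< partial_homeo (pcomp f g) >].
Proof. by apply/asboolP/pcomp_partial_homeo; exact/asboolP/phomeoP. Qed.

Definition mul_phomeo (f g : phomeo X) : phomeo X :=
  Phomeo (mul_phomeo_subproof f g).

Fact mul_phomeoA : associative mul_phomeo.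
Proof.
move=> f g h; apply: val_inj; apply/funext => x /=.
by rewrite /pcomp; case: (phomeo_fun h x).
Qed.

HB.instance Definition _ := isSemigroup.Build (phomeo X) mul_phomeoA.

End PhomeoSemigroup.

Record invAction (S : invSemigroupType) (X : topologicalType) := InvAction {
  act :> {multiplicative S -> phomeo X};
  act_cover : \bigcup_(s in [set: S]) pdom (act s) = [set: X]
}.

Definition action_morphism (S T : invSemigroupType) (X Y : topologicalType)
    (alpha : invAction S X) (beta : invAction T Y)
    (theta : {multiplicative S -> T}) (xi : Y -> option X) : Prop :=
  [/\ partial_map xi,
      forall s : S, ppreim xi (pdom (alpha s)) = pdom (beta (theta s)) &
      forall (s : S) (y : Y), ppreim xi (pdom (alpha s)) y ->
        pcomp (alpha s) xi y = pcomp xi (beta (theta s)) y].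

Definition proper_action_morphism (S T : invSemigroupType)
    (X Y : topologicalType) (alpha : invAction S X) (beta : invAction T Y)
    (theta : {multiplicative S -> T}) (xi : Y -> option X) : Prop :=
  action_morphism alpha beta theta xi /\ proper_map xi.

Section Spectrum.
Variable S : invSemigroupType.

(* {0,1} is bool, with multiplication && *)
Definition spec0 : set {ptws idem S -> bool} :=
  [set zeta | forall e f : idem S, zeta (e * f) = zeta e && zeta f].

Definition spec : set {ptws idem S -> bool} := spec0 `\ (fun=> false).

Definition specU (e : idem S) : set spec := [set zeta : spec | set_val zeta e = true].

Definition conj_char (s : S) (zeta : {ptws idem S -> bool}) :
  {ptws idem S -> bool} := fun e => zeta (conjs s e).

(* insub never fails on U_s, see spectral_fun_val *)
Definition spectral_fun (s : S) (zeta : spec) : option spec :=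
  if `[< specU (src s) zeta >] then insub (conj_char s (set_val zeta)) else None.

Lemma specM (zeta : spec) e f :
  set_val zeta (e * f) = set_val zeta e && set_val zeta f.
Proof. by case: zeta => z zP; have [+ _] := set_mem zP; apply. Qed.

Lemma spec_nz (zeta : spec) : exists e, set_val zeta e.
Proof.
case: zeta => z zP; have [_ nz] := set_mem zP.
apply: contrapT => h; apply: nz; apply/funext => e /=.
by apply/negP => ze; apply: h; exists e.
Qed.

Lemma spec_intro (z : {ptws idem S -> bool}) (e : idem S) :
  (forall e f, z (e * f) = z e && z f) -> z e -> z \in spec.
Proof. by move=> zM ze; apply/mem_set; split=> // z0; rewrite z0 in ze. Qed.

Lemma conj_char_spec (s : S) (zeta : spec) :
  specU (src s) zeta -> conj_char s (set_val zeta) \in spec.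
Proof.
move=> zs; apply: (@spec_intro _ (src s^*)); last first.
  rewrite /conj_char.
  suff -> : conjs s (src s^*) = src s by [].
  by apply: val_inj; rewrite /= starK !mulgA star_mulK.
move=> e f; rewrite /conj_char -specM; congr (set_val zeta _).
apply: val_inj => /=.
have -> : s^* * idem_val e * s * (s^* * idem_val f * s)
        = s^* * (idem_val e * (s * s^*)) * (idem_val f * s).
  by rewrite !mulgA.
by rewrite (idemC (idemE e) (mulsV_idem s)) !mulgA star_mulK.
Qed.

Lemma spectral_fun_val (s : S) (zeta : spec) (zs : specU (src s) zeta) :
  spectral_fun s zeta = Some (exist (fun z => z \in spec) _ (conj_char_spec zs)).
Proof.
rewrite /spectral_fun asboolT //.
exact: (insubT (fun z => z \in spec) (conj_char_spec zs)).
Qed.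

Lemma spectral_funP (s : S) (zeta eta : spec) :
  spectral_fun s zeta = Some eta <->
  specU (src s) zeta /\ set_val eta = conj_char s (set_val zeta).
Proof.
split=> [|[zs etaE]].
  rewrite /spectral_fun; case: asboolP => // zs; case: insubP => // u _ uE [<-].
  by split.
by rewrite (spectral_fun_val zs); congr Some; apply: val_inj.
Qed.

Lemma pdom_spectral_fun (s : S) : pdom (spectral_fun s) = specU (src s).
Proof.
apply/seteqP; split=> zeta; rewrite /pdom /=; last first.
  by move=> zs; rewrite (spectral_fun_val zs).
by rewrite /spectral_fun; case: asboolP.
Qed.

Lemma ptws_comp_continuous (I : Type) (J : eqType) (k : I -> J) :
  continuous (fun z : {ptws J -> bool} => (fun i => z (k i)) : {ptws I -> bool}).
Proof.
move=> z; apply/cvg_sup => i U.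
set T := initial_topology _ => nU.
have [V [[W oW WV] Vz] VU] : exists2 V, @open_nbhs T (fun i => z (k i)) V & V `<=` U.
  by move: nU; rewrite (@nbhsE T) => -[V ? ?]; exists V.
have Wz : W (z (k i)) by move: Vz; rewrite -WV.
have nW : nbhs z (@proj _ (fun=> bool) (k i) @^-1` W).
  by apply: proj_continuous; exact: open_nbhs_nbhs.
apply: (@filterS _ (nbhs z) _ _ _ _ nW) => z' Wz'.
by apply: VU; rewrite -WV.
Qed.

Lemma conj_char_continuous (s : S) : continuous (conj_char s).
Proof. exact: ptws_comp_continuous. Qed.

Lemma specU_open (e : idem S) : open (specU e).
Proof.
rewrite openE /interior => zeta ze.
suff : nbhs zeta (set_val @^-1` (@proj _ (fun=> bool) e @^-1` [set true])) by [].
apply: (@initial_continuous spec _ set_val); apply: proj_continuous.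
by apply: open_nbhs_nbhs; split=> //; exact: discrete_open.
Qed.

Lemma spectral_fun_partial_map (s : S) : partial_map (spectral_fun s).
Proof.
apply/partial_mapP => zeta eta /spectral_funP[zs etaE] V nV.
move: (nV); rewrite (@nbhsE (set_type spec)) => -[U [[W oW WU] Ueta] UV].
have Weta : W (conj_char s (set_val zeta)) by rewrite -etaE; move: Ueta; rewrite -WU.
have nW : nbhs zeta (set_val @^-1` (conj_char s @^-1` W)).
  apply: (@initial_continuous spec _ set_val); apply: conj_char_continuous.
  exact: open_nbhs_nbhs.
have nU := open_nbhs_nbhs (conj (specU_open (src s)) zs).
apply: (@filterS _ (nbhs zeta) _ _ _ _ (filterI nW nU)) => z [/= Wz zs'].
exists (exist (fun z => z \in spec) _ (conj_char_spec zs')); first exact: spectral_fun_val.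
by apply: UV; rewrite -WU.
Qed.

Lemma spectral_funK (s : S) (zeta eta : spec) :
  spectral_fun s zeta = Some eta -> spectral_fun s^* eta = Some zeta.
Proof.
move=> /spectral_funP[zs etaE]; apply/spectral_funP; split.
  rewrite /specU /= etaE /conj_char.
  suff -> : conjs s (src s^*) = src s by [].
  by apply: val_inj; rewrite /= starK !mulgA star_mulK.
apply/funext => e; rewrite etaE /conj_char.
have -> : conjs s (conjs s^* e) = src s * e * src s.
  by apply: val_inj; rewrite /= starK !mulgA.
by rewrite !specM (zs : set_val zeta (src s) = true) andbT.
Qed.

Lemma spectral_fun_homeo (s : S) : partial_homeo (spectral_fun s).
Proof.
split; first exact: spectral_fun_partial_map.
exists (spectral_fun s^*); first exact: spectral_fun_partial_map.
move=> zeta eta; split; first exact: spectral_funK.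
by move=> /spectral_funK; rewrite starK.
Qed.

Definition spectral_homeo (s : S) : phomeo spec :=
  Phomeo (asboolT (spectral_fun_homeo s)).

Fact spectral_homeoM : {morph spectral_homeo : s t / s * t}.
Proof.
move=> s t; apply: val_inj; apply/funext => zeta /=; rewrite /pcomp.
have conjM e : conjs (s * t) e = conjs t (conjs s e).
  by apply: val_inj; rewrite /= starM !mulgA.
have srcM : src (s * t) = conjs t (src s).
  by apply: val_inj; rewrite /= starM !mulgA.
case tz: (spectral_fun t zeta) => [eta|] /=.
  have /spectral_funP[zt etaE] := tz.
  case sz: (spectral_fun s eta) => [mu|] /=.
    have /spectral_funP[es muE] := sz.
    apply/spectral_funP; split.
      by rewrite /specU /= srcM; move: es; rewrite /specU /= etaE.
    by rewrite muE etaE; apply/funext => e; rewrite /conj_char conjM.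
  case stz: (spectral_fun _ _) => [mu|] //.
  have /spectral_funP[+ _] := stz; rewrite /specU /= srcM => zst.
  have es : specU (src s) eta by rewrite /specU /= etaE.
  by rewrite (spectral_fun_val es) in sz.
case stz: (spectral_fun _ _) => [mu|] //.
have /spectral_funP[+ _] := stz; rewrite /specU /= => zst.
suff zt : specU (src t) zeta by rewrite (spectral_fun_val zt) in tz.
have : src (s * t) = src (s * t) * src t.
  by apply: val_inj; rewrite /= -!mulgA (mulgA t) mul_starK.
by move: zst => /[swap] ->; rewrite specM => /andP[].
Qed.

HB.instance Definition _ :=
  isMultiplicative.Build S (phomeo spec) spectral_homeo spectral_homeoM.

Fact spectral_cover :
  \bigcup_(s in [set: S]) pdom (spectral_homeo s) = [set: spec].
Proof.
apply/seteqP; split=> // zeta _; have [e ze] := spec_nz zeta.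
exists (idem_val e) => //; rewrite /= pdom_spectral_fun /specU /=.
suff -> : src (idem_val e) = e by [].
by apply: val_inj; rewrite /= (idem_star (idemE e)) idemE.
Qed.

Definition spectral_action : invAction S spec :=
  @InvAction S spec spectral_homeo spectral_cover.

End Spectrum.

Arguments spec0 : clear implicits.
Arguments spec : clear implicits.

Section InducedMap.
Variables (S T : invSemigroupType) (theta : {multiplicative S -> T}).

Fact idem_map_subproof (e : idem S) :
  theta (idem_val e) * theta (idem_val e) == theta (idem_val e).
Proof. by rewrite -gmulfM idemE. Qed.

Definition idem_map (e : idem S) : idem T := Idem (idem_map_subproof e).

Definition pullback (zeta : {ptws idem T -> bool}) : {ptws idem S -> bool} :=
  fun e => zeta (idem_map e).

Lemma pullback_spec0 zeta : spec0 T zeta -> spec0 S (pullback zeta).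
Proof.
move=> zM e f; rewrite /pullback -zM; congr zeta.
by apply: val_inj; rewrite /= gmulfM.
Qed.

(* insub: undefined exactly where the pullback is not in spec S *)
Definition theta_hat (zeta : spec T) : option (spec S) :=
  insub (pullback (set_val zeta)).

Lemma pdom_theta_hat :
  pdom theta_hat = [set zeta | spec S (pullback (set_val zeta))].
Proof.
apply/seteqP; split=> zeta; rewrite /pdom /theta_hat /=.
  by case: insubP => // u uS _ _; exact: set_mem uS.
by case: insubP => //= /negP + /mem_set.
Qed.

End InducedMap.

(* Main.v *)
Require Import Defs.
From mathcomp Require Import all_boot monoid all_classical topology.

(** A homomorphism of inverse semigroups commutes with [star], because the
    inverse is unique; hence the map it induces on idempotents sends [src s] to
    [src (theta s)] and intertwines the conjugations [e |-> s^* e s]. Both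
    conditions of an action morphism are then formal: the pullback of a
    character [zeta] takes on [src s] the value of [zeta] on [src (theta s)]
    ([theta_hat_specU]), and pulling back commutes with the conjugation of
    characters ([theta_hat_equivariant]). Continuity with open domain is local:
    pulling back is continuous on the full product space, and the domain of
    [theta_hat] is covered by the open sets [specU (idem_map theta e)].

    Properness is where the point [0] removed from the spectrum matters
    ([theta_hat_proper]). Spectra are in general not closed in the product
    space, but [0] pulls back to [0], which is not in [spec S]. So, for a compact
    [C] in [spec S], the preimage of [C] is computed among all characters in
    [spec0 T], including [0], without gaining a point: it is a closed subset
    of the compact space of all functions [idem T -> bool]. It remains to
    see that compactness is intrinsic ([compact_set_val]). *)

Set Implicit Arguments.
Unset Strict Implicit.
Unset Printing Implicit Defensive.

Local Open Scope group_scope.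
Local Open Scope classical_set_scope.

Lemma gmulf_star (S T : invSemigroupType) (theta : {multiplicative S -> T})
    (s : S) : theta s^* = (theta s)^*.
Proof. by apply: star_uniq; rewrite -!gmulfM ?mul_starK ?star_mulK. Qed.

Lemma idem_map_src (S T : invSemigroupType) (theta : {multiplicative S -> T})
    (s : S) : idem_map theta (src s) = src (theta s).
Proof. by apply: val_inj; rewrite /= gmulfM gmulf_star. Qed.

Lemma idem_map_conjs (S T : invSemigroupType) (theta : {multiplicative S -> T})
    (s : S) (e : idem S) :
  idem_map theta (conjs s e) = conjs (theta s) (idem_map theta e).
Proof. by apply: val_inj; rewrite /= !gmulfM gmulf_star. Qed.

Lemma pullback_specM (S T : invSemigroupType) (theta : {multiplicative S -> T})
    (zeta : spec T) (e f : idem S) :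
  pullback theta (set_val zeta) (e * f) =
  pullback theta (set_val zeta) e && pullback theta (set_val zeta) f.
Proof. by apply: pullback_spec0 e f => e f; exact: specM. Qed.

Lemma theta_hatP (S T : invSemigroupType) (theta : {multiplicative S -> T})
    (zeta : spec T) (eta : spec S) :
  theta_hat theta zeta = Some eta <->
  set_val eta = pullback theta (set_val zeta).
Proof.
rewrite /theta_hat; split=> [|etaE].
  by case: insubP => // u _ uE [<-].
by rewrite -etaE; exact: valK.
Qed.

(** A homomorphism to [{0,1}] belongs to the spectrum once it takes the value 1
    somewhere, so one idempotent of [S] whose image [zeta] does not kill already
    witnesses that the pullback is nonzero. *)
Lemma theta_hat_defined (S T : invSemigroupType)
    (theta : {multiplicative S -> T}) (zeta : spec T) (e : idem S) :
  set_val zeta (idem_map theta e) ->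
  exists eta, theta_hat theta zeta = Some eta.
Proof.
move=> ze.
have zS : pullback theta (set_val zeta) \in spec S.
  by apply: (@spec_intro _ _ e) ze => e' f'; exact: pullback_specM.
by exists (exist (fun z => z \in spec S) _ zS); apply/theta_hatP.
Qed.

(** The right-hand side lies in the domain of [theta_hat], since a character
    equal to 1 at the image of [e] has a nonzero pullback. *)
Lemma theta_hat_specU (S T : invSemigroupType)
    (theta : {multiplicative S -> T}) (e : idem S) :
  ppreim (theta_hat theta) (specU e) = specU (idem_map theta e).
Proof.
apply/seteqP; split=> zeta; rewrite /specU /=.
  by case=> eta /theta_hatP etaE; rewrite /= etaE.
move=> ze; have [eta zeta_eta] := theta_hat_defined ze.
by exists eta => //; have /theta_hatP /= -> := zeta_eta.
Qed.

Lemma nbhs_coord_eq (I : eqType) (z : {ptws I -> bool}) (i : I) :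
  nbhs z [set z' | z' i = z i].
Proof.
have nzi : nbhs (@proj _ (fun=> bool) i z) [set z i].
  by apply: open_nbhs_nbhs; split=> //; exact: discrete_open.
exact: (@proj_continuous I (fun=> bool) i z _ nzi).
Qed.

(** Each multiplicativity equation involves three coordinates only, so it can be
    read off from a nearby character which agrees at these coordinates. *)
Lemma spec0_closed (S : invSemigroupType) : closed (spec0 S).
Proof.
move=> z clz e f.
have [z' [z'M [[<- <-] <-]]] := clz _ (filterI (filterI
  (nbhs_coord_eq z e) (nbhs_coord_eq z f)) (nbhs_coord_eq z (e * f))).
exact: z'M.
Qed.

Lemma ptws_bool_compact (I : eqType) : compact [set: {ptws I -> bool}].
Proof.
have := @tychonoff I (fun=> bool) (fun=> setT) (fun=> bool_compact).
by congr compact; apply/seteqP; split.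
Qed.

Lemma ptws_bool_hausdorff (I : eqType) : hausdorff_space {ptws I -> bool}.
Proof. by apply: hausdorff_product => _; exact: discrete_hausdorff. Qed.

Lemma nbhs_set_val (X : topologicalType) (A : set X) (x : A) (V : set A) :
  nbhs x V -> exists2 W, nbhs (set_val x) W & set_val @^-1` W `<=` V.
Proof.
rewrite (@nbhsE (set_type A)) => -[U [[W oW WU] Ux] UV].
exists W; last by rewrite WU.
by apply: open_nbhs_nbhs; split=> //; move: Ux; rewrite -WU.
Qed.

(** Compactness of a subset of a subspace may be tested in the ambient space: a
    filter on the subspace is pushed forward along the inclusion, and a cluster
    point of the image that lies in [K] is a cluster point of the filter, the
    neighbourhoods in the subspace being traces. *)
Lemma compact_set_val (X : topologicalType) (A : set X) (K : set A) :
  compact (set_val @` K) -> compact K.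
Proof.
move=> cK F FF FK.
have FsK : (set_val @ F) (set_val @` K).
  by apply: (@filterS _ F _ K) => // x Kx; exists x.
have [_ [[x Kx <-] clx]] := cK (set_val @ F) _ FsK.
exists x; split=> // B V FB /nbhs_set_val[W nW WV].
have FsB : (set_val @ F) (set_val @` B).
  by apply: (@filterS _ F _ B) => // y By; exists y.
have [_ [[y By <-] Wy]] := clx _ _ FsB nW.
by exists y; split=> //; exact: WV.
Qed.

(** The preimage of a compact set is closed in the compact space of all functions
    [idem T -> bool], because removing [0] from [spec0 T] does not change it. *)
Lemma theta_hat_proper (S T : invSemigroupType)
    (theta : {multiplicative S -> T}) : proper_map (theta_hat theta).
Proof.
move=> C cC; apply: compact_set_val.
have cC' : closed (set_val @` C).
  apply: compact_closed; first exact: ptws_bool_hausdorff.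
  apply: continuous_compact cC; apply: continuous_subspaceT.
  exact: initial_continuous.
have -> : set_val @` ppreim (theta_hat theta) C =
    spec0 T `&` pullback theta @^-1` (set_val @` C).
  apply/seteqP; split=> [_ [zeta [eta /theta_hatP etaE Ceta] <-]|].
    by split; [exact: specM | exists eta].
  move=> z [zM [eta Ceta etaE]].
  (* z is nonzero because its pullback eta is *)
  have [e etae] := spec_nz eta.
  have zT : z \in spec T.
    by apply: (@spec_intro _ _ (idem_map theta e)) => //; move: etae; rewrite etaE.
  exists (exist (fun z => z \in spec T) z zT) => //.
  by exists eta => //; apply/theta_hatP.
apply: (subclosed_compact _ (@ptws_bool_compact (idem T))) => //.
apply: closedI; first exact: spec0_closed.
by apply: preimage_closed cC' => z _; exact: ptws_comp_continuous.
Qed.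

Lemma theta_hat_partial_map (S T : invSemigroupType)
    (theta : {multiplicative S -> T}) : partial_map (theta_hat theta).
Proof.
apply/partial_mapP => zeta eta zeta_eta V /nbhs_set_val[W nW WV].
have /theta_hatP etaE := zeta_eta.
have nW' : nbhs zeta (set_val @^-1` (pullback theta @^-1` W)).
  apply: (@initial_continuous (spec T) _ set_val).
  by apply: ptws_comp_continuous; move: nW; rewrite etaE.
(* an idempotent at which eta is 1 gives a neighbourhood specU on which the
   pullback stays in the spectrum *)
have [e etae] := spec_nz eta.
have ze : specU (idem_map theta e) zeta.
  by rewrite -theta_hat_specU; exists eta.
have nU := open_nbhs_nbhs (conj (specU_open (idem_map theta e)) ze).
apply: (@filterS _ (nbhs zeta) _ _ _ _ (filterI nW' nU)) => z [/= Wz zU].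
have [mu zmu] := theta_hat_defined zU.
exists mu => //; apply: WV.
by have /theta_hatP muE := zmu; rewrite /= muE.
Qed.

Lemma theta_hat_equivariant (S T : invSemigroupType)
    (theta : {multiplicative S -> T}) (s : S) (zeta : spec T) :
  ppreim (theta_hat theta) (specU (src s)) zeta ->
  pcomp (spectral_fun s) (theta_hat theta) zeta =
  pcomp (theta_hat theta) (spectral_fun (theta s)) zeta.
Proof.
move=> zs; have zts : specU (src (theta s)) zeta.
  by rewrite -idem_map_src -theta_hat_specU.
case: zs => eta zeta_eta etas; rewrite /pcomp zeta_eta /=.
rewrite (spectral_fun_val etas) (spectral_fun_val zts) /=.
have /theta_hatP etaE := zeta_eta; apply/esym/theta_hatP.
rewrite -[LHS]/(conj_char s (set_val eta)) etaE.
by apply/funext => e; rewrite /conj_char /pullback idem_map_conjs.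
Qed.

Theorem proposition3p11 (S T : invSemigroupType)
    (theta : {multiplicative S -> T}) :
  proper_action_morphism (spectral_action S) (spectral_action T)
    theta (theta_hat theta).
Proof.
split; last exact: theta_hat_proper.
split; first exact: theta_hat_partial_map.
- by move=> s; rewrite /= !pdom_spectral_fun theta_hat_specU idem_map_src.
- move=> s zeta; rewrite /= pdom_spectral_fun.
  exact: theta_hat_equivariant.
Qed.
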